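(* Let $\mathcal{A}\in\mathbb{R}^{n_1\times\dots\times n_d}$ and, for $k=1,\dots,d$, let $X_k\in\mathbb{R}^{\left(\prod_{j\ne k}n_j\right)\times r_k}$ and $Y_k\in\mathbb{R}^{n_k\times(r_k+\ell_k)}$ be Gaussian matrices such that $\mathcal{A}_kX_k$ has full column rank and $Y_k^T\mathcal{A}_kX_k$ is tall (i.e. $\ell_k\ge1$). Suppose that $\epsilon=O(u\|\mathcal{A}\|_F)$, where $u$ is the unit roundoff, and that each row of $$\widetilde W_k:=\mathcal{A}_kX_k(Y_k^T\mathcal{A}_kX_k)_\epsilon^\dagger\in\mathbb{R}^{n_k\times(r_k+\ell_k)}$$ is computed by a backward stable underdetermined linear solver, the computed matrix being denoted by $\mathrm{fl}(\widetilde W_k)$. Suppose that $\mathcal{C}\times_{k=1}^d\widetilde W_k=(\mathcal{A}\times_{k=1}^dY_k^T)\times_{k=1}^d\mathcal{A}_kX_k(Y_k^T\mathcal{A}_kX_k)_\epsilon^\dagger$ is formed by first computing the core tensor $\mathcal{C}=\mathcal{A}\times_{k=1}^dY_k^T$ and the matrices $\widetilde W_k$, and then performing the mode products between $\mathcal{C}$ and the $\widetilde W_k$. Set $$\widetilde\varepsilon_k:=\|\mathcal{A}-\mathcal{A}\times_k\mathrm{fl}(\widetilde W_k)Y_k^T\|_F\quad\text{and}\quad\widetilde\tau_k:=1+\|\mathrm{fl}(\widetilde W_k)\|_2\|Y_k^T\|_2 .$$ Then, denoting $\widetilde\varepsilon:=\max_k\widetilde\varepsilon_k$ and $\widetilde\tau:=\max_k\widetilde\tau_k$,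 we have $$\|\mathcal{A}-\mathcal{C}\times_{k=1}^d\mathrm{fl}(\widetilde W_k)\|_F\le\frac{\widetilde\varepsilon}{\widetilde\tau}\big((1+\widetilde\tau)^d-1\big).$$
   Context: For a tensor $\mathcal{A}\in\mathbb{R}^{n_1\times\dots\times n_d}$, $\mathcal{A}_k\in\mathbb{R}^{n_k\times\prod_{j\ne k}n_j}$ denotes its mode-$k$ matricization: $(\mathcal{A}_k)_{i_k,j}=\mathcal{A}_{i_1,\dots,i_d}$ with $j=1+\sum_{t\neq k}(i_t-1)J_t$, $J_t=\prod_{s<t,\,s\ne k}n_s$. The mode-$k$ product of $\mathcal{A}$ with $M\in\mathbb{R}^{J\times n_k}$ is the tensor $\mathcal{A}\times_kM$ with entries $(\mathcal{A}\times_kM)_{i_1\dots i_{k-1}\,j\,i_{k+1}\dots i_d}=\sum_{s=1}^{n_k}\mathcal{A}_{i_1\dots i_{k-1}\,s\,i_{k+1}\dots i_d}M_{js}$, and $\mathcal{A}\times_{k=1}^dM_k=\mathcal{A}\times_1M_1\times_2\dots\times_dM_d$. $\|\cdot\|_F$ is the Frobenius norm and $\|\cdot\|_2$ the spectral norm. For a matrix $M$ with SVD $M=[U_1\ U_2]\,\mathrm{diag}(\Sigma_1,\Sigma_2)\,[V_1\ V_2]^T$, where $\Sigma_1$ contains the singular values larger than $\epsilon$, the $\epsilon$-pseudoinverse is $M_\epsilon^\dagger:=V_1\Sigma_1^{-1}U_1^T$. A Gaussian matrix has independent standard normal entries. $\mathrm{fl}(\cdot)$ denotes the outcome of a computation in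 floating point arithmetic with unit roundoff $u$; the $O(\cdot)$ may hide factors depending on the dimensions $n_k$ and ranks $r_k$ but not on $1/\epsilon$ or on singular values of $\mathcal{A}_k$. The model of computation is: $\mathcal{A}_kX_k$ and $Y_k^T\mathcal{A}_kX_k$ are computed exactly; backward stability of the row solver means that the $i$th row of $\mathrm{fl}(\widetilde W_k)$ equals $([\mathcal{A}_kX_k]_i+\delta_i)(Y_k^T\mathcal{A}_kX_k+\Delta_i)_\epsilon^\dagger$ for some perturbations with $\|\delta_i\|_F,\|\Delta_i\|_F=O(u\|\mathcal{A}\|_F)$, where $[M]_i$ is the $i$th row of $M$; in the quantity bounded in the conclusion, $\mathcal{C}$ is the exact tensor $\mathcal{A}\times_{k=1}^dY_k^T$ and the mode products with the matrices $\mathrm{fl}(\widetilde W_k)$ are exact, so the only rounding errors are those in $\mathrm{fl}(\widetilde W_k)$. *)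

(* Defs.v *)
From HB Require Import structures.
From mathcomp Require Import all_boot all_order all_algebra.
From mathcomp Require Import all_classical all_reals all_analysis.

Set Implicit Arguments.
Unset Strict Implicit.
Unset Printing Implicit Defensive.

Import Order.TTheory GRing.Theory Num.Theory.

Local Open Scope classical_set_scope.
Local Open Scope ring_scope.

(* Modes and indices are numbered from 0. *)
Definition midx (d : nat) (n : 'I_d -> nat) : finType :=
  {dffun forall k : 'I_d, 'I_(n k)}.

Definition tensor (R : realType) (d : nat) (n : 'I_d -> nat) : zmodType :=
  {ffun midx n -> R}.

Section Tensors.
Variables (R : realType) (d : nat).
Implicit Types (n m : 'I_d -> nat) (k : 'I_d).

Definition tfnorm n (A : tensor R n) : R :=
  Num.sqrt (\sum_(i : midx n) A i ^+ 2).

Definition codim n k : nat := (\prod_(j < d | j != k) n j)%N.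

Definition colidx n k (i : midx n) : nat :=
  (\sum_(t < d | t != k) i t * \prod_(s < d | (s < t) && (s != k)) n s)%N.

(* Multi-indices correspond bijectively to pairs (i k, colidx k i) with
   colidx k i < codim n k, so exactly one term survives in the sum. *)
Definition matricize n (A : tensor R n) k : 'M[R]_(n k, codim n k) :=
  \matrix_(a, c) \sum_(i : midx n | (i k == a) && (colidx k i == c)) A i.

(* Mode-k product. The shape n' of the result is meant to agree with n except
   in mode k. The sum runs over the indices i' that agree with i in all modes
   but k, i.e. over the value i' k. *)
Definition modeprod n n' k (A : tensor R n) (M : 'M[R]_(n' k, n k)) :
    tensor R n' :=
  [ffun i : midx n' =>
    \sum_(i' : midx n |
          [forall j : 'I_d, (j != k) ==> (i' j == i j :> nat)])
      A i' * M (i k) (i' k)].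

(* The shape after the products in the modes 0, ..., t-1. *)
Definition stepdim m n (t : nat) : 'I_d -> nat :=
  fun k => if (k < t)%N then m k else n k.

Lemma stepdim_ge m n k : n k = stepdim m n k k.
Proof. by rewrite /stepdim ltnn. Qed.

Lemma stepdim_lt m n k : m k = stepdim m n k.+1 k.
Proof. by rewrite /stepdim ltnSn. Qed.

Lemma stepdim_d m n k : stepdim m n d k = m k.
Proof. by rewrite /stepdim ltn_ord. Qed.

Definition tcast n n' (e : forall k, n k = n' k) (A : tensor R n) :
    tensor R n' :=
  [ffun i : midx n' => A [ffun k => cast_ord (esym (e k)) (i k)]].

Fixpoint modeprods_upto m n (M : forall k, 'M[R]_(m k, n k)) (A : tensor R n)
    (t : nat) : (t <= d)%N -> tensor R (stepdim m n t) :=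
  match t return (t <= d)%N -> tensor R (stepdim m n t) with
  | 0%N => fun _ => A
  | t'.+1 => fun h =>
      let k := Ordinal h in
      @modeprod (stepdim m n t') (stepdim m n t'.+1) k
        (modeprods_upto M A (ltnW h))
        (castmx (stepdim_lt m n k, stepdim_ge m n k) (M k))
  end.

(* A x_1 M_1 x_2 ... x_d M_d *)
Definition modeprods m n (A : tensor R n) (M : forall k, 'M[R]_(m k, n k)) :
    tensor R m :=
  tcast (stepdim_d m n) (modeprods_upto M A (leqnn d)).

End Tensors.

Section Matrices.
Variable R : realType.

Definition fnorm p q (M : 'M[R]_(p, q)) : R :=
  Num.sqrt (\sum_(i < p) \sum_(j < q) M i j ^+ 2).

(* On column vectors fnorm is the Euclidean norm. *)
Definition specnorm p q (M : 'M[R]_(p, q)) : R :=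
  sup [set fnorm (M *m x) | x in [set x : 'cV[R]_q | fnorm x <= 1]].

(* P is an eps-pseudoinverse of M, read off from a reduced singular value
   decomposition whose singular values are split at eps. For eps >= 0 the
   matrix P does not depend on the decomposition. *)
Definition is_eps_pinv p q (eps : R) (M : 'M[R]_(p, q)) (P : 'M[R]_(q, p)) :
    Prop :=
  exists (a b : nat) (U1 : 'M[R]_(p, a)) (U2 : 'M[R]_(p, b))
         (s1 : 'rV[R]_a) (s2 : 'rV[R]_b)
         (V1 : 'M[R]_(q, a)) (V2 : 'M[R]_(q, b)),
    [/\ (a + b)%N = minn p q,
        (row_mx U1 U2)^T *m row_mx U1 U2 = 1%:M,
        (row_mx V1 V2)^T *m row_mx V1 V2 = 1%:M,
        (forall i, eps < s1 0 i) /\ (forall i, 0 <= s2 0 i <= eps) &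
        M = row_mx U1 U2 *m block_mx (diag_mx s1) 0 0 (diag_mx s2)
              *m (row_mx V1 V2)^T] /\
    P = V1 *m invmx (diag_mx s1) *m U1^T.

(* W is a computed version of B S_eps^+, each row being obtained by a backward
   stable solver with backward errors of norm at most etaB and etaS. *)
Definition rowwise_backward_stable p q r (eps etaB etaS : R)
    (B : 'M[R]_(p, q)) (S : 'M[R]_(r, q)) (W : 'M[R]_(p, r)) : Prop :=
  forall i : 'I_p,
    exists (delta : 'rV[R]_q) (Delta : 'M[R]_(r, q)) (P : 'M[R]_(q, r)),
      [/\ fnorm delta <= etaB, fnorm Delta <= etaS,
          is_eps_pinv eps (S + Delta) P & row i W = (row i B + delta) *m P].

End Matrices.

Section GaussianMatrices.
Context {disp : measure_display} {T : measurableType disp} {R : realType}.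
Variable P : probability T R.

Definition random_mx (p q : nat) := 'I_p -> 'I_q -> {RV P >-> R}.

Definition outcome p q (X : random_mx p q) (w : T) : 'M[R]_(p, q) :=
  \matrix_(i, j) X i j w.

(* Taking some of the sets B i j to be setT gives the product rule for every
   subfamily of entries. *)
Definition independent_entries p q (X : random_mx p q) : Prop :=
  forall B : 'I_p -> 'I_q -> set R,
    (forall i j, measurable (B i j)) ->
    P [set w | forall i j, B i j (X i j w)] =
    (\prod_(i < p) \prod_(j < q) P (X i j @^-1` B i j))%E.

Definition gaussian_mx p q (X : random_mx p q) : Prop :=
  (forall i j (B : set R), measurable B ->
     distribution P (X i j) B = normal_prob 0 1 B) /\
  independent_entries X.

End GaussianMatrices.

(* Main.v *)
Require Import Defs.
From HB Require Import structures.
From mathcomp Require Import all_boot all_order all_algebra.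
From mathcomp Require Import all_classical all_reals all_analysis.
From mathcomp Require Import ring lra.
Import Order.TTheory GRing.Theory Num.Theory.
Local Open Scope ring_scope.

(** Write [W k] for the computed factors and put [Z k := W k *m (Y k)^T].

    Mode products in distinct modes commute and products in the same mode
    compose, so that [C x_1 W_1 ... x_d W_d] is obtained from [A] by applying
    the mode products with [Z 0, ..., Z (d-1)] one after the other.  Let [B t]
    be the tensor after the first [t] of them.  From
    [A - B t.+1 = (A - A x_t Z_t) + (A - B t) x_t Z_t]
    and [|| T x_t Z_t ||_F <= || W_t ||_2 || Y_t^T ||_2 || T ||_F] one gets
    [e t.+1 <= eps + (tau - 1) * e t] for [e t := || A - B t ||_F], where [eps]
    and [tau] are the two maxima.  Replacing [tau - 1] by [1 + tau] and summing
    the geometric series gives [tau * e t <= eps * ((1 + tau) ^+ t - 1)].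

    The lemmas that carry this are [modeprods_multilin], which evaluates a chain
    of mode products applied to a multilinear image of [A] and is used for [Y]
    and then for [W]; [tfnorm_modeprod], the norm estimate, proved by applying the
    matrix bound to each mode-[k] fibre; and [telescoping_error], the recursion
    for [e t]. They are combined in [modeprods_error]. *)

(** * Euclidean norms *)

Section EuclideanNorm.
Variables (R : realType) (I : finType).
Implicit Types f g : I -> R.

Lemma sumsqr_ge0 f : 0 <= \sum_i f i ^+ 2.
Proof. by apply: sumr_ge0 => i _; exact: sqr_ge0. Qed.

(** Lagrange's identity: the difference of the two sides is half the sum of the
    squares [(f i * g j - f j * g i) ^+ 2]. *)
Lemma cauchy_schwarz_sum f g :
  (\sum_i f i * g i) ^+ 2 <= (\sum_i f i ^+ 2) * (\sum_i g i ^+ 2).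
Proof.
have lagrange : \sum_i \sum_j (f i * g j - f j * g i) ^+ 2 =
    2 * ((\sum_i f i ^+ 2) * (\sum_i g i ^+ 2) - (\sum_i f i * g i) ^+ 2).
  pose p := \sum_i \sum_j f i ^+ 2 * g j ^+ 2.
  pose q := \sum_i \sum_j (f i * g i) * (f j * g j).
  have -> : (\sum_i f i ^+ 2) * (\sum_i g i ^+ 2) = p.
    by rewrite mulr_suml; apply: eq_bigr => i _; rewrite mulr_sumr.
  have -> : (\sum_i f i * g i) ^+ 2 = q.
    by rewrite expr2 mulr_suml; apply: eq_bigr => i _; rewrite mulr_sumr.
  have -> : 2 * (p - q) =
      p + \sum_i \sum_j f j ^+ 2 * g i ^+ 2 +
      \sum_i \sum_j (- 2) * ((f i * g i) * (f j * g j)).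
    rewrite [X in p + X + _]exchange_big -/p /=.
    have -> : \sum_i \sum_j (- 2) * ((f i * g i) * (f j * g j)) = (- 2) * q.
      by rewrite mulr_sumr; apply: eq_bigr => i _; rewrite mulr_sumr.
    by ring.
  rewrite -!big_split; apply: eq_bigr => i _ /=.
  by rewrite -!big_split; apply: eq_bigr => j _ /=; ring.
have : 0 <= \sum_i \sum_j (f i * g j - f j * g i) ^+ 2.
  by apply: sumr_ge0 => i _; exact: sumsqr_ge0.
by rewrite lagrange; lra.
Qed.

Lemma minkowski_sum f g :
  Num.sqrt (\sum_i (f i + g i) ^+ 2) <=
  Num.sqrt (\sum_i f i ^+ 2) + Num.sqrt (\sum_i g i ^+ 2).
Proof.
set a := \sum_i f i ^+ 2; set b := \sum_i g i ^+ 2.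
have cs : \sum_i f i * g i <= Num.sqrt a * Num.sqrt b.
  rewrite -sqrtrM ?sumsqr_ge0 //; apply: le_trans (ler_norm _) _.
  by rewrite -sqrtr_sqr ler_wsqrtr // cauchy_schwarz_sum.
rewrite -ler_sqr ?nnegrE ?addr_ge0 ?sqrtr_ge0 //.
rewrite sqrrD !sqr_sqrtr ?sumsqr_ge0 //.
have -> : \sum_i (f i + g i) ^+ 2 = a + (\sum_i f i * g i) *+ 2 + b.
  rewrite -sumrMnl -!big_split; apply: eq_bigr => i _ /=; exact: sqrrD.
by rewrite lerD2r lerD2l lerMn2r cs orbT.
Qed.

End EuclideanNorm.

(** * The spectral norm *)

Section SpectralNorm.
Variable R : realType.

Lemma fnorm_ge0 p q (M : 'M[R]_(p, q)) : 0 <= fnorm M.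
Proof. exact: sqrtr_ge0. Qed.

Lemma sqr_fnorm p q (M : 'M[R]_(p, q)) :
  fnorm M ^+ 2 = \sum_i \sum_j M i j ^+ 2.
Proof. by rewrite sqr_sqrtr //; apply: sumr_ge0 => i _; exact: sumsqr_ge0. Qed.

Lemma sqr_fnorm_col p (x : 'cV[R]_p) : fnorm x ^+ 2 = \sum_i x i 0 ^+ 2.
Proof. by rewrite sqr_fnorm; apply: eq_bigr => i _; rewrite big_ord1. Qed.

Lemma fnorm0 p q : fnorm (0 : 'M[R]_(p, q)) = 0.
Proof.
by apply/eqP; rewrite -sqrf_eq0 sqr_fnorm big1 // => i _;
  rewrite big1 // => j _; rewrite mxE expr0n.
Qed.

Lemma fnorm_eq0 p (x : 'cV[R]_p) : fnorm x = 0 -> x = 0.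
Proof.
move=> x0; have : \sum_i x i 0 ^+ 2 = 0 by rewrite -sqr_fnorm_col x0 expr0n.
move/psumr_eq0P => x00; apply/matrixP => i j; rewrite ord1 mxE.
by apply/eqP; rewrite -sqrf_eq0 x00 // => k _; exact: sqr_ge0.
Qed.

Lemma fnormZ p q (a : R) (M : 'M[R]_(p, q)) : fnorm (a *: M) = `|a| * fnorm M.
Proof.
rewrite /fnorm -sqrtr_sqr -sqrtrM ?sqr_ge0 // mulr_sumr; congr Num.sqrt.
apply: eq_bigr => i _; rewrite mulr_sumr.
by apply: eq_bigr => j _; rewrite mxE exprMn.
Qed.

Lemma fnorm_mulmx_col p q (M : 'M[R]_(p, q)) (x : 'cV[R]_q) :
  fnorm (M *m x) <= fnorm M * fnorm x.
Proof.
rewrite -ler_sqr ?nnegrE ?mulr_ge0 ?fnorm_ge0 // exprMn !sqr_fnorm_col sqr_fnorm.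
rewrite mulr_suml; apply: ler_sum => i _; rewrite mxE.
exact: cauchy_schwarz_sum.
Qed.

(** The supremum in the definition of [specnorm] is finite because the
    Frobenius norm bounds the set. *)
Lemma specnorm_ub p q (M : 'M[R]_(p, q)) (x : 'cV[R]_q) :
  fnorm x <= 1 -> fnorm (M *m x) <= specnorm M.
Proof.
move=> x1; apply: ub_le_sup; last by exists x.
exists (fnorm M) => _ [y /= y1 <-].
apply: le_trans (fnorm_mulmx_col _ _ _ _) _.
by rewrite ler_piMr // fnorm_ge0.
Qed.

Lemma specnorm_ge0 p q (M : 'M[R]_(p, q)) : 0 <= specnorm M.
Proof.
apply: le_trans (fnorm_ge0 _ _ _) (specnorm_ub _ _ M 0 _).
by rewrite fnorm0 ler01.
Qed.

Lemma fnorm_le_specnorm p q (M : 'M[R]_(p, q)) (x : 'cV[R]_q) :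
  fnorm (M *m x) <= specnorm M * fnorm x.
Proof.
have [x0|x0] := eqVneq (fnorm x) 0.
  by rewrite (fnorm_eq0 _ _ x0) mulmx0 !fnorm0 mulr0.
have xgt0 : 0 < fnorm x by rewrite lt_def x0 fnorm_ge0.
have := specnorm_ub _ _ M ((fnorm x)^-1 *: x).
rewrite fnormZ -scalemxAr fnormZ ger0_norm ?invr_ge0 ?fnorm_ge0 //.
by rewrite mulVf // lexx mulrC ler_pdivrMr // => ->.
Qed.

End SpectralNorm.

(** * Multi-indices and fibres *)

Section MultiIndices.
Context {d : nat}.
Implicit Types (n m : 'I_d -> nat) (k : 'I_d).

Lemma midx_inj n (i j : midx n) : (forall k, i k = j k :> nat) -> i = j.
Proof. by move=> ij; apply/ffunP => k; apply: val_inj; exact: ij. Qed.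

Lemma upd_subproof m n k (e : forall j, j != k -> m j = n j)
    (i : midx m) (a : 'I_(n k)) (j : 'I_d) :
  ((if j == k then a : nat else i j) < n j)%N.
Proof. by case: (eqVneq j k) => [->|/e <-]. Qed.

(** Replaces the index in mode [k].  The shape of the result may differ from
    that of [i] in this mode; working with values in [nat] avoids a cast in the
    other modes, where the shapes agree propositionally. *)
Definition upd m n k (e : forall j, j != k -> m j = n j)
    (i : midx m) (a : 'I_(n k)) : midx n :=
  [ffun j => Ordinal (upd_subproof m n k e i a j)].

Lemma updE m n k e (i : midx m) (a : 'I_(n k)) j :
  upd m n k e i a j = (if j == k then a : nat else i j) :> nat.
Proof. by rewrite ffunE. Qed.

Lemma upd_same m n k e (i : midx m) (a : 'I_(n k)) : upd m n k e i a k = a.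
Proof. by apply: val_inj; rewrite /= updE eqxx. Qed.

(** The multi-indices that agree with [i] off mode [k] form the mode-[k] fibre
    through [i], which the index in mode [k] parametrizes. *)
Lemma sum_fibre (V : nmodType) m n k e (i : midx m) (F : midx n -> V) :
  \sum_(i' : midx n | [forall j, (j != k) ==> (i' j == i j :> nat)]) F i' =
  \sum_a F (upd m n k e i a).
Proof.
rewrite (reindex_onto (upd m n k e i) (fun i' => i' k)) /=; last first.
  move=> i' /forallP agree; apply: midx_inj => j; rewrite updE.
  case: eqVneq => [->//|jk].
  by move: (agree j); rewrite jk => /eqP.
apply: eq_bigl => a; rewrite upd_same eqxx andbT.
by apply/forallP => j; apply/implyP => /negPf jk; rewrite updE jk.
Qed.

(** Every multi-index lies on exactly one fibre, and each fibre contains exactly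
    one multi-index whose entry in mode [k] is [a0]. *)
Lemma sum_by_fibres (V : nmodType) n k (a0 : 'I_(n k)) (F : midx n -> V) :
  \sum_i F i =
  \sum_(i : midx n | i k == a0) \sum_a F (upd n n k (fun _ _ => erefl) i a).
Proof.
set u := upd n n k _.
rewrite (partition_big (fun i => u i a0) (fun i : midx n => i k == a0)) /=; last first.
  by move=> i _; rewrite /u upd_same.
apply: eq_bigr => i /eqP ik; rewrite -(sum_fibre _ _ _ k).
apply: eq_bigl => i'; apply/eqP/forallP => [<- j|agree].
  by apply/implyP => /negPf jk; rewrite updE jk.
apply: midx_inj => j; rewrite updE; case: eqVneq => [->|jk]; first by rewrite ik.
by move: (agree j); rewrite jk => /eqP.
Qed.

End MultiIndices.

(** * Chains of mode products *)

Section ModeProducts.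
Context {R : realType} {d : nat}.
Implicit Types (n m : 'I_d -> nat) (k : 'I_d) (K : 'I_d -> nat -> nat -> R).

(** Extension by zero.  Entries indexed by [nat] allow matrices whose dimensions
    agree only propositionally to be compared. *)
Definition entry p q (M : 'M[R]_(p, q)) (a b : nat) : R :=
  if insub a is Some i then if insub b is Some j then M i j else 0 else 0.

Lemma entryE p q (M : 'M[R]_(p, q)) (i : 'I_p) (j : 'I_q) : entry p q M i j = M i j.
Proof. by rewrite /entry !valK. Qed.

Definition mul_entry p q (M : 'M[R]_(p, q)) (f : nat -> nat -> R) (a c : nat) : R :=
  \sum_(b < q) entry p q M a b * f b c.

Lemma mul_entry_cast p q p' q' (e : (p = p') * (q = q')) (M : 'M[R]_(p, q)) f :
  mul_entry p' q' (castmx e M) f = mul_entry p q M f.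
Proof. by case: e => e1 e2; subst. Qed.

Lemma mul_entryA p q s (M : 'M[R]_(p, q)) (N : 'M[R]_(q, s)) f (a : 'I_p) c :
  mul_entry p q M (mul_entry q s N f) a c = mul_entry p s (M *m N) f a c.
Proof.
rewrite /mul_entry; under eq_bigr do rewrite mulr_sumr.
rewrite exchange_big; apply: eq_bigr => b _ /=.
rewrite entryE mxE mulr_suml; apply: eq_bigr => j _.
by rewrite !entryE mulrA.
Qed.

(** The image of [A] under the tensor product of the matrices with entries
    [K k a b], that is, all mode products at once. *)
Definition multilin n m (K : 'I_d -> nat -> nat -> R) (A : tensor R n) : tensor R m :=
  [ffun i : midx m => \sum_(i' : midx n) A i' * \prod_k K k (i k) (i' k)].

Lemma eq_multilin n m (K K' : 'I_d -> nat -> nat -> R) (A : tensor R n) :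
  (forall k (a : 'I_(m k)) (b : 'I_(n k)), K k a b = K' k a b) ->
  multilin n m K A = multilin n m K' A.
Proof.
move=> KK'; apply/ffunP => i; rewrite !ffunE; apply: eq_bigr => i' _.
by congr (_ * _); apply: eq_bigr => k _; exact: KK'.
Qed.

Definition delta (a b : nat) : R := (a == b)%:R.

Lemma multilin_delta n (A : tensor R n) : multilin n n (fun=> delta) A = A.
Proof.
apply/ffunP => i; rewrite ffunE (bigD1 i) //= [X in _ + X]big1 ?addr0.
  by rewrite big1 ?mulr1 // => k _; rewrite /delta eqxx.
move=> i' i'i; have [k ik] : exists k, i k != i' k.
  apply/existsP; rewrite -negb_forall; apply: contra i'i => /forallP ii'.
  by apply/eqP/ffunP => k; apply/eqP; rewrite eq_sym.
by rewrite (bigD1 k) //= /delta (negPf (ik : (i k : nat) != i' k)) mul0r mulr0.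
Qed.

(** Only the factor in mode [k] of the product over the modes varies along a
    mode-[k] fibre. *)
Lemma modeprod_multilin n m m' k (e : forall j, j != k -> m' j = m j)
    K (A : tensor R n) (M : 'M[R]_(m' k, m k)) :
  modeprod (multilin n m K A) M =
  multilin n m' (fun j => if j == k then mul_entry (m' k) (m k) M (K k) else K j) A.
Proof.
apply/ffunP => i; rewrite !ffunE (sum_fibre _ _ _ _ e).
under eq_bigr do rewrite ffunE mulr_suml.
rewrite exchange_big; apply: eq_bigr => i' _ /=.
under eq_bigr do rewrite -mulrA.
rewrite -mulr_sumr; congr (_ * _).
rewrite [RHS](bigD1 k) //= eqxx /mul_entry mulr_suml.
apply: eq_bigr => b _; rewrite (bigD1 k) //= upd_same entryE mulrC mulrA.
congr (_ * _); apply: eq_bigr => j /negPf jk.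
by rewrite updE jk.
Qed.

Lemma modeprods_upto_multilin n0 n m K (A : tensor R n0)
    (M : forall k, 'M[R]_(m k, n k)) t (h : (t <= d)%N) :
  modeprods_upto M (multilin n0 n K A) h =
  multilin n0 (stepdim m n t)
    (fun k => if (k < t)%N then mul_entry (m k) (n k) (M k) (K k) else K k) A.
Proof.
elim: t h => [|t IH] h /=; first exact: eq_multilin.
set k := Ordinal h.
have e j : j != k -> stepdim m n t.+1 j = stepdim m n t j.
  by move=> jk; rewrite /stepdim ltnS leq_eqVlt (negPf (jk : (j : nat) != t)).
rewrite IH (modeprod_multilin _ _ _ _ e) mul_entry_cast.
apply: eq_multilin => j a b; move: (a : nat) (b : nat) => {}a {}b; rewrite ltnn.
case: eqVneq => [->|jk]; first by rewrite ltnSn.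
by rewrite [(j < t.+1)%N]ltnS [(j <= t)%N]leq_eqVlt (negPf (jk : (j : nat) != t)).
Qed.

(** A chain of mode products composes with a multilinear map mode by mode. *)
Lemma modeprods_multilin n0 n m K (A : tensor R n0)
    (M : forall k, 'M[R]_(m k, n k)) :
  modeprods (multilin n0 n K A) M =
  multilin n0 m (fun k => mul_entry (m k) (n k) (M k) (K k)) A.
Proof.
rewrite /modeprods modeprods_upto_multilin; apply/ffunP => i; rewrite !ffunE.
apply: eq_bigr => i' _; congr (_ * _); apply: eq_bigr => k _.
by rewrite ltn_ord ffunE.
Qed.

Lemma modeprodsA n m p (A : tensor R n) (M : forall k, 'M[R]_(m k, n k))
    (N : forall k, 'M[R]_(p k, m k)) :
  modeprods (modeprods A M) N =
  multilin n p (fun k => mul_entry (p k) (n k) (N k *m M k) delta) A.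
Proof.
rewrite -{1}(multilin_delta n A) !modeprods_multilin.
by apply: eq_multilin => k a b; rewrite mul_entryA.
Qed.

(** * Error propagation *)

Lemma tfnorm_ge0 n (A : tensor R n) : 0 <= tfnorm A.
Proof. exact: sqrtr_ge0. Qed.

Lemma ler_tfnormD n (A B : tensor R n) : tfnorm (A + B) <= tfnorm A + tfnorm B.
Proof.
rewrite /tfnorm; under eq_bigr do rewrite ffunE.
exact: minkowski_sum.
Qed.

Lemma modeprodB n m k (A B : tensor R n) (M : 'M[R]_(m k, n k)) :
  modeprod (A - B) M = modeprod A M - modeprod B M :> tensor R m.
Proof.
apply/ffunP => i; rewrite !ffunE -sumrB; apply: eq_bigr => i' _.
by rewrite !ffunE mulrBl.
Qed.

(** On each mode-[k] fibre the mode product is the multiplication of a column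
    vector by the matrix, and the squared Frobenius norm is the sum over the
    fibres. *)
Lemma tfnorm_modeprod n k (A : tensor R n) (M : 'M[R]_(n k)) (s : R) :
  0 <= s -> (forall x : 'cV[R]_(n k), fnorm (M *m x) <= s * fnorm x) ->
  tfnorm (modeprod A M : tensor R n) <= s * tfnorm A.
Proof.
move=> s0 Ms; rewrite /tfnorm -{1}(ger0_norm s0) -sqrtr_sqr -sqrtrM ?sqr_ge0 //.
apply: ler_wsqrtr.
(* Fibres are indexed through a fixed entry [a0] in mode [k]; without such an
   entry there are no multi-indices at all. *)
case: (pickP (@predT 'I_(n k))) => [a0 _|empty]; last first.
  by rewrite !big1 ?mulr0 // => i _; have := empty (i k).
rewrite !(sum_by_fibres _ n k a0) mulr_sumr; apply: ler_sum => i _.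
set u := upd n n k _ i.
pose x : 'cV[R]_(n k) := \col_a A (u a).
have -> : \sum_a A (u a) ^+ 2 = fnorm x ^+ 2.
  by rewrite sqr_fnorm_col; apply: eq_bigr => a _; rewrite mxE.
have -> : \sum_a (modeprod A M : tensor R n) (u a) ^+ 2 = fnorm (M *m x) ^+ 2.
  rewrite sqr_fnorm_col; apply: eq_bigr => a _; congr (_ ^+ 2).
  rewrite ffunE (sum_fibre _ n n k (fun _ _ => erefl)) mxE.
  apply: eq_bigr => b _; rewrite !upd_same mxE mulrC; congr (_ * A _).
  by apply: midx_inj => j; rewrite !updE; case: eqP.
by rewrite -exprMn ler_sqr ?nnegrE ?mulr_ge0 ?fnorm_ge0.
Qed.

(** Adding and subtracting [A x_t Z_t] separates the error committed in mode [t]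
    from the propagated one. The first [t] modes are the ones already
    multiplied. *)
Lemma telescoping_error n (A : tensor R n) (Z : forall k, 'M[R]_(n k)) (eps q : R) :
  0 <= q ->
  (forall k, tfnorm (A - (modeprod A (Z k) : tensor R n)) <= eps) ->
  (forall k (x : 'cV[R]_(n k)), fnorm (Z k *m x) <= q * fnorm x) ->
  let B t := multilin n n
    (fun k => if (k < t)%N then mul_entry (n k) (n k) (Z k) delta else delta) A in
  forall t, (t < d)%N -> tfnorm (A - B t.+1) <= eps + q * tfnorm (A - B t).
Proof.
move=> q0 Aeps Zq B t td; pose k : 'I_d := Ordinal td.
have BS : B t.+1 = modeprod (B t) (Z k).
  rewrite (modeprod_multilin _ _ _ k (fun _ _ => erefl)).
  apply: eq_multilin => j a b; move: (a : nat) (b : nat) => {}a {}b; rewrite ltnn.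
  case: eqVneq => [->|jk]; first by rewrite ltnSn.
  by rewrite [(j < t.+1)%N]ltnS [(j <= t)%N]leq_eqVlt (negPf (jk : (j : nat) != t)).
have -> : A - B t.+1 = (A - (modeprod A (Z k) : tensor R n)) +
    (modeprod (A - B t) (Z k) : tensor R n).
  by rewrite modeprodB BS addrA subrK.
by apply: le_trans (ler_tfnormD _ _ _) _; apply: lerD => //; exact: tfnorm_modeprod.
Qed.

End ModeProducts.

(** The right-hand side solves [b t.+1 = eps + (1 + tau) * b t] with
    [b 0 = 0]. *)
Lemma geometric_bound (R : realType) (a : nat -> R) (eps q tau : R) (d : nat) :
  0 < tau -> 0 <= eps -> 0 <= q <= 1 + tau -> a 0%N <= 0 ->
  (forall t, (t < d)%N -> a t.+1 <= eps + q * a t) ->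
  a d <= eps / tau * ((1 + tau) ^+ d - 1).
Proof.
move=> tau0 eps0 /andP[q0 qtau] a0 step.
suff : forall t, (t <= d)%N -> a t <= eps / tau * ((1 + tau) ^+ t - 1) by apply.
have et0 : 0 <= eps / tau by rewrite divr_ge0 // ltW.
elim=> [|t IH] td; first by rewrite expr0 subrr mulr0.
apply: le_trans (step t td) _.
have pow1 : 0 <= (1 + tau) ^+ t - 1 by rewrite subr_ge0 exprn_ege1 // lerDl ltW.
have -> : eps / tau * ((1 + tau) ^+ t.+1 - 1) =
    eps + (1 + tau) * (eps / tau * ((1 + tau) ^+ t - 1)).
  by rewrite exprS; field; rewrite gt_eqF.
rewrite lerD2l; apply: le_trans (ler_wpM2l q0 (IH (ltnW td))) _.
by rewrite ler_wpM2r // mulr_ge0.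
Qed.

(** The square matrix [W k *m V k] has spectral norm at most
    [specnorm (W k) * specnorm (V k)], hence at most [taut - 1]; this is the ratio
    in the recursion for the partial products. Since [d] is positive, [taut] is
    at least [1], so that this ratio is nonnegative. *)
Lemma modeprods_error (R : realType) (d : nat) (hd : (0 < d)%N)
    (n m : 'I_d -> nat) (A : tensor R n)
    (V : forall k, 'M[R]_(m k, n k)) (W : forall k, 'M[R]_(n k, m k)) :
  let epst := \big[Num.max/0]_(k < d)
    tfnorm (A - (modeprod A (W k *m V k) : tensor R n)) in
  let taut := \big[Num.max/0]_(k < d) (1 + specnorm (W k) * specnorm (V k)) in
  tfnorm (A - modeprods (modeprods A V) W) <= epst / taut * ((1 + taut) ^+ d - 1).
Proof.
pose epsk k := tfnorm (A - (modeprod A (W k *m V k) : tensor R n)).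
pose tauk k := 1 + specnorm (W k) * specnorm (V k).
cbv zeta.
set epst := \big[_/_]_(k < d) epsk k; set taut := \big[_/_]_(k < d) tauk k.
pose Z k := W k *m V k.
pose B t := multilin n n
  (fun k => if (k < t)%N then mul_entry (n k) (n k) (Z k) delta else delta) A.
have epskP k : epsk k <= epst by exact: le_bigmax.
have taukP k : tauk k <= taut by exact: le_bigmax.
have tauk1 k : 1 <= tauk k by rewrite lerDl mulr_ge0 ?specnorm_ge0.
have taut1 : 1 <= taut := le_trans (tauk1 (Ordinal hd)) (taukP (Ordinal hd)).
have epst0 : 0 <= epst := le_trans (tfnorm_ge0 _ _) (epskP (Ordinal hd)).
have taut_1 : 0 <= taut - 1 by rewrite subr_ge0.
have Zq k (x : 'cV[R]_(n k)) : fnorm (Z k *m x) <= (taut - 1) * fnorm x.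
  rewrite -mulmxA; apply: le_trans (fnorm_le_specnorm _ _ _ _ _) _.
  apply: le_trans (ler_wpM2l (specnorm_ge0 _ _ _ _) (fnorm_le_specnorm _ _ _ _ _)) _.
  by rewrite mulrA ler_wpM2r ?fnorm_ge0 // lerBrDl taukP.
have -> : modeprods (modeprods A V) W = B d.
  by rewrite modeprodsA; apply: eq_multilin => k a b; rewrite ltn_ord.
apply: (geometric_bound R (fun t => tfnorm (A - B t)) epst (taut - 1)) => //.
- exact: lt_le_trans ltr01 taut1.
- by rewrite taut_1; lra.
- have -> : B 0%N = A by rewrite -[RHS]multilin_delta; exact: eq_multilin.
  rewrite subrr /tfnorm big1 ?sqrtr0 // => i _.
  by rewrite ffunE expr0n.
- exact: telescoping_error.
Qed.

Theorem theorem5p8 (R : realType) (d : nat) (hd : (0 < d)%N)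
    (n r l : 'I_d -> nat) (hl : forall k, (1 <= l k)%N)
    (* implied constants: fixed by d, n, r, l, before A, u and eps *)
    (ceps cdelta cDelta : R)
    (A : tensor R n) (u eps : R) (hu : 0 < u) (heps : 0 <= eps)
    (heps_O : eps <= ceps * (u * tfnorm A))
    (disp : measure_display) (T : measurableType disp) (P : probability T R)
    (X : forall k, random_mx P (codim n k) (r k))
    (Y : forall k, random_mx P (n k) (r k + l k))
    (hX : forall k, gaussian_mx (X k))
    (hY : forall k, gaussian_mx (Y k))
    (w : T)
    (hrank : forall k, \rank (matricize A k *m outcome (X k) w) = r k)
    (flW : forall k, 'M[R]_(n k, r k + l k))
    (hflW : forall k,
        rowwise_backward_stable eps
          (cdelta * (u * tfnorm A)) (cDelta * (u * tfnorm A))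
          (matricize A k *m outcome (X k) w)
          ((outcome (Y k) w)^T *m matricize A k *m outcome (X k) w)
          (flW k)) :
  let C := modeprods A (fun k => (outcome (Y k) w)^T) in
  let epsk k := tfnorm (A - modeprod (n' := n) (k := k) A
                              (flW k *m (outcome (Y k) w)^T)) in
  let tauk k := 1 + specnorm (flW k) * specnorm (outcome (Y k) w)^T in
  let epst := \big[Num.max/0]_(k < d) epsk k in
  let taut := \big[Num.max/0]_(k < d) tauk k in
  tfnorm (A - modeprods C flW) <= epst / taut * ((1 + taut) ^+ d - 1).
Proof. exact: modeprods_error. Qed.
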